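(* Let $(X,d)$ be a metric space (not necessarily finite) and let $p \ge 0$ be a real number. Then $(X,d)$ is of strict $p$-negative type if and only if $(X,d)$ does not admit any nontrivial $p$-polygonal equality.
   Context: Convention: $d(x,x)^p = 0$ for all $p \ge 0$, including $p=0$ (i.e. $0^0=0$). Strict $p$-negative type. A finite metric space $(\{x_1,\dots,x_m\},d)$ with $m$ distinct points is of $p$-negative type if $\sum_{i,j=1}^m d(x_i,x_j)^p \xi_i\xi_j \le 0$ for all $(\xi_1,\dots,\xi_m)\in\mathbb{R}^m$ with $\sum_i \xi_i = 0$; it is of strict $p$-negative type if moreover the inequality is strict for every such nonzero $(\xi_1,\dots,\xi_m)$. A general metric space is of (strict) $p$-negative type if every finite metric subspace of it is of (strict) $p$-negative type. Polygonal equalities. A signed simplex $Q=[x_i(m_i);y_j(n_j)]_{s,t}$ in $X$ consists of (not necessarily distinct) points $x_1,\dots,x_s,y_1,\dots,y_t\in X$ together with real weights $m_1,\dots,m_s,n_1,\dots,n_t$ satisfying $m_1+\cdots+m_s=n_1+\cdots+n_t$. Its $p$-simplex gap is $$\gamma_p(Q)=\sum_{i=1}^s\sum_{j=1}^t m_in_j\,d(x_i,y_j)^p-\sum_{1\le i_1<i_2\le s}m_{i_1}m_{i_2}\,d(x_{i_1},x_{i_2})^p-\sum_{1\le j_1<j_2\le t}n_{j_1}n_{j_2}\,d(y_{j_1},y_{j_2})^p.$$ A $p$-polygonal equality in $(X,d)$ is an equality $\gamma_p(Q)=0$ for some signed simplex $Q$ in $X$. A signed simplex $Q$ is nondegenerate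 if the net weights $\sum_{i: x_i=z}m_i-\sum_{j:y_j=z}n_j$, $z\in X$, are not all zero (equivalently, by merging repeated points, cancelling, and moving negative weights to the other side, $Q$ can be reduced to a signed simplex with all points distinct and all weights strictly positive). A $p$-polygonal equality $\gamma_p(Q)=0$ is nontrivial if $Q$ is nondegenerate. *)

(* Defs.v *)
From HB Require Import structures.
From mathcomp Require Import all_boot all_order all_algebra.
From mathcomp Require Import reals topology exp.

Set Implicit Arguments.
Unset Strict Implicit.
Unset Printing Implicit Defensive.

Import Order.TTheory GRing.Theory Num.Theory.

Local Open Scope ring_scope.

Section StrictNegativeType.
Context {R : realType} {X : metricType R}.

(* The case split implements the convention d(x,x)^p = 0 for all p >= 0; it
   matters only at p = 0, where the library has [0 `^ 0 = 1]. *)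
Definition mdist_pow (p : R) (x y : X) : R :=
  if x == y then 0 else powR (mdist x y) p.

(* The finite metric space {x_1,...,x_m} is given by the enumeration [x] of its
   points, which is required to be injective in [strict_negative_type]. *)
Definition fin_negative_type (p : R) (m : nat) (x : 'I_m -> X) : Prop :=
  forall xi : 'rV[R]_m, \sum_i xi 0 i = 0 ->
    \sum_i \sum_j mdist_pow p (x i) (x j) * xi 0 i * xi 0 j <= 0.

Definition fin_strict_negative_type (p : R) (m : nat) (x : 'I_m -> X) : Prop :=
  fin_negative_type p x /\
  forall xi : 'rV[R]_m, \sum_i xi 0 i = 0 -> xi != 0 ->
    \sum_i \sum_j mdist_pow p (x i) (x j) * xi 0 i * xi 0 j < 0.

End StrictNegativeType.

Definition strict_negative_type (R : realType) (X : metricType R) (p : R) :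
    Prop :=
  forall (m : nat) (x : 'I_m -> X), injective x -> fin_strict_negative_type p x.

(* [x_i(m_i); y_j(n_j)]_{s,t}, where s, t are [ls], [rs]; x_i, m_i are [lpt],
   [lwt]; and y_j, n_j are [rpt], [rwt]. *)
Record signed_simplex (R : realType) (X : metricType R) := SignedSimplex {
  ls : nat;
  rs : nat;
  ls_gt0 : (0 < ls)%N;
  rs_gt0 : (0 < rs)%N;
  lpt : 'I_ls -> X;
  lwt : 'I_ls -> R;
  rpt : 'I_rs -> X;
  rwt : 'I_rs -> R;
  weight_balance : \sum_i lwt i = \sum_j rwt j
}.

Section PolygonalEqualities.
Context {R : realType} {X : metricType R}.
Implicit Type Q : signed_simplex X.

Definition simplex_gap (p : R) Q : R :=
    \sum_(i < ls Q) \sum_(j < rs Q)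
      lwt i * rwt j * mdist_pow p (lpt i) (rpt j)
  - \sum_(i1 < ls Q) \sum_(i2 < ls Q | (i1 < i2)%N)
      lwt i1 * lwt i2 * mdist_pow p (lpt i1) (lpt i2)
  - \sum_(j1 < rs Q) \sum_(j2 < rs Q | (j1 < j2)%N)
      rwt j1 * rwt j2 * mdist_pow p (rpt j1) (rpt j2).

Definition net_weight Q (z : X) : R :=
  \sum_(i < ls Q | lpt i == z) lwt i - \sum_(j < rs Q | rpt j == z) rwt j.

Definition nondegenerate Q : Prop := exists z : X, net_weight Q z != 0.

Definition polygonal_equality (p : R) Q : Prop := simplex_gap p Q = 0.

Definition nontrivial_polygonal_equality (p : R) Q : Prop :=
  polygonal_equality p Q /\ nondegenerate Q.

End PolygonalEqualities.

(* Main.v *)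
Require Import Defs.
From HB Require Import structures.
From mathcomp Require Import all_boot all_order all_algebra.
From mathcomp Require Import reals topology exp.
From mathcomp Require Import ring lra.

Set Implicit Arguments.
Unset Strict Implicit.
Unset Printing Implicit Defensive.

Import Order.TTheory GRing.Theory Num.Theory.

Local Open Scope ring_scope.

(** Twice the gap of a signed simplex is minus its energy, the double sum of
    w_a w_b d(z_a, z_b)^p over all its points z_a, where the left points carry
    their weights and the right points carry the opposites of theirs
    ([double_simplex_gap], [energy_simplex]).  The balance condition says that
    these signed weights add up to 0, and merging repeated points leaves the
    energy unchanged ([energy_merge]).  So a signed simplex is, as far as its
    gap is concerned, a zero-sum vector of net weights on a finite set of
    distinct points; nondegeneracy says that this vector is nonzero, and the
    gap vanishes exactly when the negative-type quadratic form does.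

    Strictness therefore excludes nontrivial equalities at once.  Conversely,
    suppose that the form is nonnegative at some nonzero zero-sum vector u.  It
    is negative at a difference of two basis vectors, where its value is
    -2 d(x_i, x_j)^p.  On the line through u in that direction it is thus a
    real quadratic with nonnegative constant term and negative leading
    coefficient, and it has a root ([energy_isotropic]).  The root is a nonzero
    zero-sum vector of energy 0, that is, a nontrivial equality. *)

(** * The energy of a weighted family of points *)

Section Energy.
Context {R : realType} {X : metricType R}.
Variable p : R.

Lemma mdist_powC (x y : X) : mdist_pow p x y = mdist_pow p y x.
Proof. by rewrite /mdist_pow eq_sym metric_sym. Qed.

Lemma mdist_powxx (x : X) : mdist_pow p x x = 0.
Proof. by rewrite /mdist_pow eqxx. Qed.

Lemma mdist_pow_gt0 (x y : X) : x != y -> 0 < mdist_pow p x y.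
Proof.
by move=> xy; rewrite /mdist_pow (negbTE xy) powR_gt0// mdist_gt0.
Qed.

(** The two families of weighted points may have different index types, so that
    the mixed term of the gap and the polar form of the energy are both
    instances. *)
Definition mutual_energy (I J : finType) (x : I -> X) (u : I -> R)
    (y : J -> X) (v : J -> R) : R :=
  \sum_i \sum_j mdist_pow p (x i) (y j) * u i * v j.

Definition energy (I : finType) (x : I -> X) (u : I -> R) : R :=
  mutual_energy x u x u.

Lemma mutual_energyC (I J : finType) (x : I -> X) u (y : J -> X) v :
  mutual_energy x u y v = mutual_energy y v x u.
Proof.
rewrite /mutual_energy exchange_big; apply: eq_bigr => j _.
by apply: eq_bigr => i _; rewrite mdist_powC mulrAC.
Qed.

Lemma energyDZ (I : finType) (x : I -> X) (u v : I -> R) (t : R) :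
  energy x (fun i => u i + t * v i) =
  energy x u + t * mutual_energy x u x v *+ 2 + t ^+ 2 * energy x v.
Proof.
rewrite mulr2n {2}mutual_energyC /energy /mutual_energy !mulr_sumr -!big_split/=.
apply: eq_bigr => i _; rewrite !mulr_sumr -!big_split/=.
by apply: eq_bigr => j _; ring.
Qed.

Lemma energyZ (I : finType) (x : I -> X) (t : R) (v : I -> R) :
  energy x (fun i => t * v i) = t ^+ 2 * energy x v.
Proof.
rewrite /energy /mutual_energy mulr_sumr; apply: eq_bigr => i _.
by rewrite mulr_sumr; apply: eq_bigr => j _; ring.
Qed.

Lemma sum_basis_diff (I : finType) (i j : I) (F : I -> R) :
  \sum_k F k * ((k == i)%:R - (k == j)%:R) = F i - F j.
Proof.
under eq_bigr do rewrite mulrBr.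
rewrite sumrB (bigD1 i)//= (bigD1 j (F := fun k => _ * (k == j)%:R))//=.
rewrite !eqxx !mulr1 !big1 ?addr0// => k /negbTE ->; exact: mulr0.
Qed.

Lemma energy_basis_diff (I : finType) (x : I -> X) (i j : I) : i != j ->
  energy x (fun k => (k == i)%:R - (k == j)%:R) =
  - (mdist_pow p (x i) (x j) *+ 2).
Proof.
move=> ij; rewrite /energy /mutual_energy.
under eq_bigr do rewrite sum_basis_diff -mulrBl.
rewrite sum_basis_diff !mdist_powxx (mdist_powC (x j)); ring.
Qed.

(** * The simplex gap as an energy *)

Lemma sum_symmetric (n : nat) (F : 'I_n -> 'I_n -> R) :
  (forall i j, F i j = F j i) -> (forall i, F i i = 0) ->
  \sum_i \sum_j F i j = (\sum_(i < n) \sum_(j < n | (i < j)%N) F i j) *+ 2.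
Proof.
move=> Fsym F0.
have -> : \sum_i \sum_j F i j =
    \sum_(i < n) \sum_(j < n | (i < j)%N) F i j +
    \sum_(i < n) \sum_(j < n | (j < i)%N) F i j.
  rewrite -big_split/=; apply: eq_bigr => i _.
  rewrite (bigID (fun j : 'I_n => (i < j)%N))/=; congr (_ + _).
  rewrite (bigD1 i) ?ltnn//= F0 add0r; apply: eq_bigl => j.
  by rewrite -leqNgt ltn_neqAle andbC.
rewrite mulr2n; congr (_ + _).
rewrite (exchange_big_dep xpredT)//=.
by apply: eq_bigr => i _; apply: eq_bigr => j _.
Qed.

Lemma energy_ord (n : nat) (x : 'I_n -> X) (u : 'I_n -> R) :
  energy x u =
  (\sum_(i < n) \sum_(j < n | (i < j)%N) u i * u j * mdist_pow p (x i) (x j)) *+ 2.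
Proof.
rewrite /energy /mutual_energy sum_symmetric.
- congr (_ *+ 2); apply: eq_bigr => i _; apply: eq_bigr => j _; ring.
- by move=> i j; rewrite mdist_powC mulrAC.
- by move=> i; rewrite mdist_powxx !mul0r.
Qed.

Lemma double_simplex_gap (Q : signed_simplex X) :
  simplex_gap p Q *+ 2 =
  mutual_energy (@lpt _ _ Q) (@lwt _ _ Q) (@rpt _ _ Q) (@rwt _ _ Q) *+ 2
  - energy (@lpt _ _ Q) (@lwt _ _ Q) - energy (@rpt _ _ Q) (@rwt _ _ Q).
Proof.
rewrite !energy_ord /simplex_gap !mulrnBl; congr (_ *+ 2 - _ - _).
apply: eq_bigr => i _; apply: eq_bigr => j _; ring.
Qed.

Definition simplex_point (Q : signed_simplex X) (a : 'I_(ls Q) + 'I_(rs Q)) : X :=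
  match a with inl i => lpt i | inr j => rpt j end.

Definition simplex_weight (Q : signed_simplex X) (a : 'I_(ls Q) + 'I_(rs Q)) : R :=
  match a with inl i => lwt i | inr j => - rwt j end.

Lemma sum_simplex_weight (Q : signed_simplex X) :
  \sum_(a : 'I_(ls Q) + 'I_(rs Q)) simplex_weight a = 0.
Proof. by rewrite big_sumType/= sumrN weight_balance subrr. Qed.

Lemma net_weightE (Q : signed_simplex X) (z : X) :
  net_weight Q z =
  \sum_(a : 'I_(ls Q) + 'I_(rs Q) | simplex_point a == z) simplex_weight a.
Proof. by rewrite big_sumType/= sumrN. Qed.

Lemma mutual_energyNr (I J : finType) (x : I -> X) u (y : J -> X) v :
  mutual_energy x u y (fun j => - v j) = - mutual_energy x u y v.
Proof.
rewrite /mutual_energy -sumrN; apply: eq_bigr => i _.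
by rewrite -sumrN; apply: eq_bigr => j _; rewrite mulrN.
Qed.

Lemma energy_simplex (Q : signed_simplex X) :
  energy (@simplex_point Q) (@simplex_weight Q) = - (simplex_gap p Q *+ 2).
Proof.
pose x := @lpt _ _ Q; pose m := @lwt _ _ Q.
pose y := @rpt _ _ Q; pose n := @rwt _ _ Q.
have -> : energy (@simplex_point Q) (@simplex_weight Q) =
    (energy x m + mutual_energy x m y (fun j => - n j)) +
    (mutual_energy y (fun j => - n j) x m + energy y (fun j => - n j)).
  rewrite {1}/energy {1}/mutual_energy big_sumType/=.
  by congr (_ + _); rewrite -big_split/=; apply: eq_bigr => i _;
    rewrite big_sumType.
rewrite (mutual_energyC y _ x) /energy !mutual_energyNr.
rewrite (mutual_energyC y _ y) mutual_energyNr double_simplex_gap.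
rewrite /energy -/x -/y -/m -/n; ring.
Qed.

(** * Merging repeated points *)

(** The sum is regrouped according to which of the distinct points x_k the
    point z_i is. *)
Lemma sum_merge (I K : finType) (z : I -> X) (w : I -> R) (x : K -> X)
    (g : X -> R) :
  injective x -> (forall i, exists k, x k = z i) ->
  \sum_i g (z i) * w i = \sum_k g (x k) * \sum_(i | z i == x k) w i.
Proof.
move=> xinj zx; under [RHS]eq_bigr do rewrite mulr_sumr.
rewrite [RHS](exchange_big_dep xpredT)//=; apply: eq_bigr => i _.
have [k xk] := zx i; rewrite (big_pred1 k) ?xk// => l.
by rewrite /= -xk eq_sym (inj_eq xinj).
Qed.

(** The energy is, in each of its two arguments, a weighted sum over the points
    of the family, and [sum_merge] applies to one argument after the other. *)
Lemma energy_merge (I K : finType) (z : I -> X) (w : I -> R) (x : K -> X) :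
  injective x -> (forall i, exists k, x k = z i) ->
  energy z w = energy x (fun k => \sum_(i | z i == x k) w i).
Proof.
move=> xinj zx.
have merge_r (J : finType) (y : J -> X) v : mutual_energy y v z w =
    mutual_energy y v x (fun k => \sum_(i | z i == x k) w i).
  apply: eq_bigr => j _.
  exact: (sum_merge _ (fun a => mdist_pow p (y j) a * v j)).
by rewrite /energy merge_r mutual_energyC merge_r.
Qed.

(** Families may list a point several times, whereas negative type only speaks
    of enumerations without repetition. *)
Lemma distinct_points (I : finType) (z : I -> X) :
  exists m (x : 'I_m -> X),
    injective x /\ forall i, exists k, x k = z i.
Proof.
pose s := undup (codom z); exists (size s), (tnth (in_tuple s)); split.
- by apply/tuple_uniqP; exact: undup_uniq.
- move=> i; have /tnthP[k ->] : z i \in in_tuple s.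
    by rewrite mem_undup codom_f.
  by exists k.
Qed.

(** * Zeros of the energy *)

(** The zero is found on the line u + t (e_i - e_j) with i <> j, along which the
    energy is a quadratic in t that opens downwards and is nonnegative at 0.
    The root is not the zero vector: otherwise u would be a nonzero multiple of
    e_i - e_j and have negative energy. *)
Lemma energy_isotropic (m : nat) (x : 'I_m -> X) (u : 'I_m -> R) :
  injective x -> \sum_i u i = 0 -> (exists k, u k != 0) -> 0 <= energy x u ->
  exists v : 'I_m -> R,
    [/\ \sum_i v i = 0, exists k, v k != 0 & energy x v = 0].
Proof.
move=> xinj u0 [i ui] Eu.
have [j ji _] : exists2 j, j != i & u j != 0.
  apply/exists_inP; apply: contraNT ui => /exists_inPn uN.
  rewrite -u0 (bigD1 i)//= big1 ?addr0// => j /uN.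
  by rewrite negbK => /eqP.
pose e k : R := (k == i)%:R - (k == j)%:R.
have e0 : \sum_k e k = 0.
  rewrite -[RHS](subrr 1) -(sum_basis_diff i j (fun=> 1)).
  by apply: eq_bigr => k _; rewrite mul1r.
have Ee : energy x e < 0.
  rewrite energy_basis_diff 1?eq_sym// oppr_lt0 pmulrn_lgt0//.
  by rewrite mdist_pow_gt0// (inj_eq xinj) eq_sym.
set a := energy x u in Eu; set c := energy x e in Ee.
pose b := mutual_energy x u x e.
have [t qt] : exists t, a + t * b *+ 2 + t ^+ 2 * c = 0.
  (* The discriminant is nonnegative because a >= 0 > c. *)
  have disc : 0 <= b ^+ 2 - a * c by nra.
  exists ((Num.sqrt (b ^+ 2 - a * c) - b) / c).
  have := sqr_sqrtr disc; set r := Num.sqrt _ => rE.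
  have c0 : c != 0 by rewrite lt_eqF.
  apply: (mulfI c0); rewrite mulr0.
  have -> : c * (a + (r - b) / c * b *+ 2 + ((r - b) / c) ^+ 2 * c) =
    a * c + r ^+ 2 - b ^+ 2 by field.
  rewrite rE; ring.
exists (fun k => u k + t * e k); split.
- by rewrite big_split/= -mulr_sumr u0 e0 mulr0 addr0.
- apply/existsP; apply: contraT => /existsPn v0.
  have uE k : u k = - t * e k.
    have := v0 k; rewrite negbK addrC addr_eq0 => /eqP te.
    by rewrite mulNr te opprK.
  have t0 : t != 0.
    by apply: contraNneq ui => t0; rewrite uE t0 oppr0 mul0r.
  have aE : a = t ^+ 2 * c.
    rewrite /a (_ : energy x u = energy x (fun k => - t * e k)).
      by rewrite energyZ sqrrN.
    by apply: eq_bigr => k _; apply: eq_bigr => l _; rewrite !uE.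
  have : t ^+ 2 * c < 0 by rewrite pmulr_rlt0// exprn_even_gt0.
  by rewrite -aE ltNge Eu.
- by rewrite energyDZ.
Qed.

(** Signed weights allow everything to be put on the left; the right-hand side
    must have at least one point, which gets weight 0. *)
Lemma isotropic_polygonal_equality (m : nat) (x : 'I_m -> X) (v : 'I_m -> R) :
  injective x -> \sum_i v i = 0 -> (exists k, v k != 0) -> energy x v = 0 ->
  exists Q : signed_simplex X, nontrivial_polygonal_equality p Q.
Proof.
move=> xinj v0 [k vk] Ev.
have balance : \sum_i v i = \sum_(j < 1) (fun=> 0 : R) j by rewrite v0 big1.
have m0 : (0 < m)%N := leq_ltn_trans (leq0n k) (ltn_ord k).
pose Q := @SignedSimplex R X m 1 m0 isT x v (fun=> x k) (fun=> 0) balance.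
exists Q; split.
- have : simplex_gap p Q *+ 2 = 0.
    rewrite double_simplex_gap/= Ev /energy.
    have mutual0 (J : finType) (y : J -> X) w :
        mutual_energy y w (fun=> x k) (fun=> 0) = 0.
      apply: big1 => i _; apply: big1 => j _; exact: mulr0.
    by rewrite !mutual0 mul0rn !subr0.
  by move/eqP; rewrite mulrn_eq0/= => /eqP.
- exists (x k); rewrite /net_weight/= [X in _ - X]big1// subr0.
  by rewrite (big_pred1 k)// => i /=; rewrite (inj_eq xinj).
Qed.

End Energy.

(** * Strict negative type and polygonal equalities *)

Theorem theorem1p3 (R : realType) (X : metricType R) (p : R) (hp : 0 <= p) :
  strict_negative_type X p <->
  ~ (exists Q : signed_simplex X, nontrivial_polygonal_equality p Q).
Proof.
split=> [strict [Q [gap0 [z]]] | noeq m x xinj].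
- have [m [x [xinj zx]]] := distinct_points (@simplex_point _ _ Q).
  pose xi : 'rV[R]_m := \row_k net_weight Q (x k).
  have xiE k : xi 0 k =
      \sum_(a : 'I_(ls Q) + 'I_(rs Q) | simplex_point a == x k)
        simplex_weight a.
    by rewrite mxE net_weightE.
  move=> zQ; have [k xk] : exists k, x k = z.
    have [a /eqP az] : exists a : 'I_(ls Q) + 'I_(rs Q), simplex_point a == z.
      apply/existsP; apply: contraNT zQ => /existsPn Qz.
      by rewrite net_weightE big_pred0// => a; exact/negbTE.
    by have [k xk] := zx a; exists k; rewrite xk.
  have xi0 : \sum_k xi 0 k = 0.
    rewrite -[RHS](sum_simplex_weight Q).
    have := sum_merge (@simplex_weight _ _ Q) (fun=> 1 : R) xinj zx.
    under eq_bigr do rewrite mul1r; move=> ->.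
    by apply: eq_bigr => l _; rewrite mul1r xiE.
  have xiN0 : xi != 0.
    by apply: contraNneq zQ => /rowP/(_ k); rewrite !mxE xk => ->.
  have E0 : energy p x (xi 0) = 0.
    have <- : - (simplex_gap p Q *+ 2) = 0 by rewrite gap0 mul0rn oppr0.
    rewrite -energy_simplex.
    rewrite (energy_merge p (@simplex_weight _ _ Q) xinj zx).
    by apply: eq_bigr => i _; apply: eq_bigr => j _; rewrite !xiE.
  have : energy p x (xi 0) < 0 := (strict m x xinj).2 xi xi0 xiN0.
  by rewrite E0 ltxx.
- have neg (xi : 'rV[R]_m) : \sum_i xi 0 i = 0 -> xi != 0 ->
      energy p x (xi 0) < 0.
    move=> xi0 xiN0; rewrite ltNge; apply/negP => E0; apply: noeq.
    have [k xik] : exists k, xi 0 k != 0.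
      apply/existsP; apply: contraNT xiN0 => /existsPn xi0'.
      by apply/eqP/rowP => k; rewrite mxE; apply/eqP; rewrite -[_ == _]negbK.
    have [v [v0 vN0 Ev]] :=
      energy_isotropic xinj xi0 (ex_intro _ k xik) E0.
    exact: isotropic_polygonal_equality xinj v0 vN0 Ev.
  split=> [xi xi0|]; last exact: neg.
  have [->|xiN0] := eqVneq xi 0; last exact/ltW/neg.
  by rewrite big1// => i _; rewrite big1// => j _; rewrite !mxE mulr0.
Qed.
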